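(* Let $R>0$ and $C_1,C_2\ge 0$ with $\max\{C_1,C_2\}>0$. In the observable infinite-server queue there exists a unique equilibrium strategy $$n_e=\max\Bigl\{N\in\mathbb{Z}: N\le \frac{2C_2-C_1+\sqrt{C_1^2+4C_2R}}{2C_2}\Bigr\}$$ (the fraction being read as its limit $1+R/C_1$ when $C_2=0$) such that customers join the system if and only if $n<n_e$. That is, $n_e$ is the unique positive integer such that, for every integer $n\ge 0$, a customer who finds $n$ customers in the system joins (equivalently, $R-(C_1n+C_2n^2)\ge 0$) if and only if $n<n_e$.
   Context: Observable infinite-server queue: an arriving customer sees the current number $n\in\{0,1,2,\dots\}$ of customers in the system before deciding. If the customer joins, the individual utility is $R-(C_1n+C_2n^2)$, where $R>0$ is the service reward and $C_1,C_2\ge 0$ are cost coefficients with $\max\{C_1,C_2\}>0$; if the customer balks, the utility is $0$. A rational customer joins if and only if the individual utility of joining is nonnegative. *)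

(* Defs.v *)
From HB Require Import structures.
From mathcomp Require Import all_boot all_order all_algebra.
From mathcomp Require Import ring lra.
From mathcomp Require Import all_classical all_reals topology normedtype realfun.

Set Implicit Arguments.
Unset Strict Implicit.
Unset Printing Implicit Defensive.

Import Order.TTheory GRing.Theory Num.Theory.
Import numFieldNormedType.Exports.
Local Open Scope classical_set_scope.
Local Open Scope ring_scope.

Definition joining_utility (R : realType) (reward c1 c2 : R) (n : nat) : R :=
  reward - (c1 * n%:R + c2 * n%:R ^+ 2).

(* [s n] is the decision of a customer who finds [n] customers in the system:
   [true] to join, [false] to balk. *)
Definition strategy := nat -> bool.

(* Service is immediate and the cost depends only on the observed state, so the
   utility of a customer does not depend on the strategy used by the others:
   a strategy is an equilibrium when it prescribes the rational decision in
   every state. A customer indifferent between joining and balking joins. *)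
Definition is_equilibrium (R : realType) (reward c1 c2 : R) (s : strategy) : Prop :=
  forall n : nat, s n <-> 0 <= joining_utility reward c1 c2 n.

Definition threshold_strategy (N : int) : strategy := fun n => n%:Z < N.

Definition threshold_fraction (R : realType) (reward c1 c2 : R) : R :=
  (2 * c2 - c1 + Num.sqrt (c1 ^+ 2 + 4 * c2 * reward)) / (2 * c2).

(* The value at [c2 = 0] is the limit of the fraction as [c2] tends to [0] from
   the right; see [threshold_fraction_cvg]. *)
Definition threshold_bound (R : realType) (reward c1 c2 : R) : R :=
  if c2 == 0 then 1 + reward / c1 else threshold_fraction reward c1 c2.

Definition is_max (A : set int) (N : int) : Prop := A N /\ ubound A N.

Lemma threshold_fraction_cvg (R : realType) (reward c1 : R) :
  0 < reward -> 0 < c1 ->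
  threshold_fraction reward c1 c2 @[c2 --> 0^'+] --> 1 + reward / c1.
Proof.
move=> r0 c0.
pose g c2 : R := 1 + 2 * reward / (Num.sqrt (c1 ^+ 2 + 4 * c2 * reward) + c1).
have s0 : Num.sqrt (c1 ^+ 2 + 4 * 0 * reward) = c1.
  by rewrite mulr0 mul0r addr0 sqrtr_sqr gtr0_norm.
have g0 : g 0 = 1 + reward / c1.
  by rewrite /g s0; field; rewrite gt_eqF //= gt_eqF // addr_gt0.
have gc : g c2 @[c2 --> (0 : R)] --> g 0.
  apply: cvgD; first exact: cvg_cst.
  apply: cvgM; first exact: cvg_cst.
  apply: cvgV; first by rewrite s0 gt_eqF // addr_gt0.
  apply: cvgD; last exact: cvg_cst.
  apply: (@continuous_comp _ _ _ (fun c2 : R => c1 ^+ 2 + 4 * c2 * reward)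
    (@Num.sqrt R) 0); last exact: sqrt_continuous.
  apply: cvgD; first exact: cvg_cst.
  apply: cvgM; last exact: cvg_cst.
  by apply: cvgM; [exact: cvg_cst|exact: cvg_id].
rewrite -g0; apply: cvg_trans; last exact: (cvg_at_right_filter gc).
apply: near_eq_cvg; near=> c2.
have c20 : 0 < c2 by near: c2; exact: nbhs_right_gt.
rewrite /g /threshold_fraction.
set D := c1 ^+ 2 + _.
have D0 : 0 <= D by rewrite addr_ge0 ?sqr_ge0 // !mulr_ge0 // ltW.
have sq : Num.sqrt D ^+ 2 = D by exact: sqr_sqrtr.
have S0 := sqrtr_ge0 D.
have h1 : Num.sqrt D + c1 != 0 by rewrite gt_eqF // ltr_wpDl.
have h2 : c2 != 0 by rewrite gt_eqF.
have e : 2 * c2 * (2 * reward) = (Num.sqrt D + c1) * (Num.sqrt D - c1).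
  have -> : (Num.sqrt D + c1) * (Num.sqrt D - c1) = Num.sqrt D ^+ 2 - c1 ^+ 2.
    by ring.
  by rewrite sq /D; ring.
have -> : 2 * reward / (Num.sqrt D + c1) = (Num.sqrt D - c1) / (2 * c2).
  by apply/eqP; rewrite eqr_div ?mulf_neq0 ?pnatr_eq0 //; apply/eqP; lra.
by field; rewrite ?h2.
Unshelve. all: by end_near. Qed.

(* Main.v *)
Require Import Defs.
From HB Require Import structures.
From mathcomp Require Import all_boot all_order all_algebra.
From mathcomp Require Import ring lra zify.
From mathcomp Require Import all_classical all_reals.

Set Implicit Arguments.
Unset Strict Implicit.
Unset Printing Implicit Defensive.

Import Order.TTheory GRing.Theory Num.Theory.
Local Open Scope classical_set_scope.
Local Open Scope ring_scope.

(** The utility of joining is a decreasing function of the number [n] of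
    customers found, so joining is rational up to its positive zero [x], which
    is [reward / c1] or a root of a quadratic polynomial. The threshold bound is
    [x + 1]: hence [n] joins iff [n + 1 <= x + 1] ([joining_utility_ge0]), and as
    [n + 1] is an integer this means [n + 1 <= floor (x + 1)], that is,
    [n < floor (x + 1)]. So the equilibria are the strategies that agree
    pointwise with the threshold strategy of the floor. The floor is positive
    because [reward >= 0] makes state [0] a joining state, and two positive
    thresholds that give the same strategy coincide
    ([threshold_strategy_inj]). *)

(** For [c2 = 0] the utility is affine in [n]. For [0 < c2], clearing the
    denominator leaves [2 * c2 * n + c1 <= sqrt D], where
    [D = c1 ^+ 2 + 4 * c2 * reward] is the discriminant; both sides are
    nonnegative, and the right square minus the left one is [4 * c2] times the
    utility. *)
Lemma joining_utility_ge0 (R : realType) (reward c1 c2 : R) (n : nat) :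
  0 <= reward -> 0 <= c1 -> 0 <= c2 -> 0 < Num.max c1 c2 ->
  (0 <= joining_utility reward c1 c2 n) =
  (n.+1%:R <= threshold_bound reward c1 c2).
Proof.
move=> r0 c10 c20; rewrite lt_max /joining_utility /threshold_bound.
have x0 : 0 <= n%:R :> R by [].
rewrite -natr1; move: x0; move: (n%:R : R) => x x0.
have [->|c2N0] := eqVneq c2 0.
  rewrite ltxx orbF => c1_gt0.
  by rewrite mul0r addr0 subr_ge0 addrC lerD2l ler_pdivlMr // mulrC.
move=> _; have c2_gt0 : 0 < c2 by rewrite lt0r c2N0.
rewrite /threshold_fraction; set D := c1 ^+ 2 + _.
have D0 : 0 <= D by rewrite addr_ge0 ?sqr_ge0 // !mulr_ge0.
rewrite ler_pdivlMr ?mulr_gt0 //.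
have -> : ((x + 1) * (2 * c2) <= 2 * c2 - c1 + Num.sqrt D) =
          (2 * c2 * x + c1 <= Num.sqrt D) by apply/idP/idP; lra.
have lhs0 : 0 <= 2 * c2 * x + c1 by rewrite addr_ge0 // !mulr_ge0.
rewrite -[RHS]ler_sqr ?nnegrE ?sqrtr_ge0 // sqr_sqrtr //.
rewrite -[RHS]subr_ge0.
have -> : D - (2 * c2 * x + c1) ^+ 2 =
          4 * c2 * (reward - (c1 * x + c2 * x ^+ 2)) by rewrite /D; ring.
by rewrite pmulr_rge0 // mulr_gt0.
Qed.

(** Positivity matters: every nonpositive threshold gives the strategy that
    always balks. *)
Lemma threshold_strategy_inj (m p : int) :
  0 < m -> 0 < p -> threshold_strategy m =1 threshold_strategy p -> m = p.
Proof.
rewrite /threshold_strategy => m0 p0 eq_mp.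
(* If [m < p], say, then state [m] separates the two strategies. *)
by have := eq_mp `|m|%N; have := eq_mp `|p|%N; lia.
Qed.

Theorem theorem1 (R : realType) (reward c1 c2 : R)
  (reward_gt0 : 0 < reward) (c1_ge0 : 0 <= c1) (c2_ge0 : 0 <= c2)
  (max_gt0 : 0 < Num.max c1 c2) :
  exists ne : int,
    [/\ is_max [set N : int | N%:~R <= threshold_bound reward c1 c2] ne,
        0 < ne,
        is_equilibrium reward c1 c2 (threshold_strategy ne),
        forall s : strategy,
          is_equilibrium reward c1 c2 s -> s =1 threshold_strategy ne
      & forall m : int,
          0 < m -> is_equilibrium reward c1 c2 (threshold_strategy m) -> m = ne].
Proof.
set b := threshold_bound reward c1 c2; set ne := Num.floor b.
have joinE n : threshold_strategy ne n = (0 <= joining_utility reward c1 c2 n).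
  rewrite joining_utility_ge0 ?(ltW reward_gt0) // -/b.
  by rewrite /threshold_strategy -lezD1 floor_ge_int intrD natr1.
have ne_gt0 : 0 < ne.
  rewrite -[0 < ne]/(threshold_strategy ne 0) joinE /joining_utility.
  by rewrite expr0n /= !mulr0 addr0 subr0 ltW.
have unique_eq s : is_equilibrium reward c1 c2 s -> s =1 threshold_strategy ne.
  by move=> eq_s n; rewrite joinE; apply/idP/idP => /eq_s.
exists ne; split=> //.
- split; first exact: floor_le.
  by move=> N /=; rewrite floor_ge_int.
- by move=> n; rewrite joinE.
- by move=> m m0 /unique_eq; exact: threshold_strategy_inj.
Qed.
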